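(* Let $G$ be a bidirected graph in which every connected component contains at least one adjacency. Then every activation class of $G$, ordered by the activation partial order $\leq_a$, is a boolean lattice.
   Context: A bidirected graph is a quintuple $G=(V,E,I,\iota,\sigma)$ where $V,E,I$ are disjoint finite sets (vertices, edges, incidences), $V$ nonempty, $\iota:I\to V\times E$ and $\sigma:I\to\{+1,-1\}$ are functions, and every edge belongs to exactly two incidences. Parallel edges and loops are allowed. Let $\overrightarrow{P}_1$ be the directed path of length 1. An incidence preserving map $\overrightarrow{P}_1\to G$ is the same as a sequence $(v,i,e,j,w)$ with $\iota(i)=(v,e)$, $\iota(j)=(w,e)$ (tail sent to $v$, head sent to $w$). It is a backstep if $i=j$, and a directed adjacency if $i\ne j$ (a loop if also $v=w$). A pre-contributor of $G$ is an incidence preserving map $p:\coprod_{v\in V}\overrightarrow{P}_1\to G$ (one copy $(\overrightarrow{P}_1)_v$ with tail $t_v$, head $h_v$ for each $v\in V$) with $p(t_v)=v$ for all $v$. A contributor is a pre-contributor with $\{p(h_v)\mid v\in V\}=V$; $\mathfrak{C}(G)$ is the set of contributors. Unpacking a pre-contributor at a vertex $v$ where $p((\overrightarrow{P}_1)_v)=(v,i,e,i,v)$ is a backstep means replacing this value by $(v,i,e,j,w)$, where $j\neq i$ is the other incidence of $e$ and $\iota(j)=(w,e)$, leaving all other values unchanged. For a contributor $c$, the permutation $v\mapsto c(h_v)$ decomposes its image into cycles; $tc(c)$ is the number of these which are not single backsteps (loops and closed weak walks of length 2 formed by two directed adjacencies count as circles). Activating a circle of $c$ is a minimal sequence of unpackings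 resulting in a contributor $c'$ with $tc(c')=tc(c)+1$. The activation partial order is: $c\leq_a d$ if $d$ is obtained from $c$ by a (possibly empty) sequence of activations. $\sim_a$ is the equivalence relation on $\mathfrak{C}(G)$ generated by comparability under $\leq_a$, and the elements of $\mathfrak{C}(G)/\sim_a$ are the activation classes of $G$. *)

(* Defs.v *)
From HB Require Import structures.
From mathcomp Require Import all_boot all_order all_algebra all_fingroup.
From Stdlib Require Import Relation_Operators.

Set Implicit Arguments.
Unset Strict Implicit.
Unset Printing Implicit Defensive.

Record bidirected_graph := BidirectedGraph {
  vertex : finType;
  edge : finType;
  incidence : finType;
  iota : incidence -> vertex * edge;
  sigma : incidence -> int;
  vertex_nonempty : 0 < #|vertex|;
  sigma_sign : forall i, (sigma i == 1%R) || (sigma i == (- 1)%R);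
  edge_incidences : forall e : edge, #|[set i | (iota i).2 == e]| = 2 }.

(** An incidence preserving map [P_1 -> G], as a sequence [(v, i, e, j, w)]. *)
Definition incidence_preserving (G : bidirected_graph)
    (s : vertex G * incidence G * edge G * incidence G * vertex G) : bool :=
  let: (v, i, e, j, w) := s in (iota i == (v, e)) && (iota j == (w, e)).

Record step (G : bidirected_graph) := Step {
  step_val : vertex G * incidence G * edge G * incidence G * vertex G;
  step_valP : incidence_preserving step_val }.

HB.instance Definition _ G := [isSub for @step_val G].
HB.instance Definition _ G := [Finite of step G by <:].

Section Steps.
Variables (G : bidirected_graph) (s : step G).

Definition tail : vertex G := let: (v, i, e, j, w) := step_val s in v.
Definition head : vertex G := let: (v, i, e, j, w) := step_val s in w.
Definition step_edge : edge G := let: (v, i, e, j, w) := step_val s in e.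

Definition is_backstep : bool := let: (v, i, e, j, w) := step_val s in i == j.
Definition is_directed_adjacency : bool := ~~ is_backstep.

End Steps.

Section Components.
Variable G : bidirected_graph.

Definition incident (v : vertex G) (e : edge G) : bool :=
  [exists i, iota i == (v, e)].

Definition incidence_rel : rel (vertex G + edge G) := fun x y =>
  match x, y with
  | inl v, inr e | inr e, inl v => incident v e
  | _, _ => false
  end.

(** Components are recorded by their vertices and edges; an incidence lies in
    the component of its vertex, which is also that of its edge. *)
Definition components : {set {set vertex G + edge G}} :=
  equivalence_partition (connect incidence_rel) [set: vertex G + edge G].

Definition has_adjacency (K : {set vertex G + edge G}) : Prop :=
  exists s : step G,
    [/\ is_directed_adjacency s, inl (tail s) \in K,
        inr (step_edge s) \in K & inl (head s) \in K].

End Components.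

(** A map out of the coproduct of the [P_1]'s is a family of maps. *)
Record pre_contributor (G : bidirected_graph) := PreContributor {
  pc_val :> {ffun vertex G -> step G};
  pc_valP : [forall v, tail (pc_val v) == v] }.

HB.instance Definition _ G := [isSub for @pc_val G].
HB.instance Definition _ G := [Finite of pre_contributor G by <:].

Record contributor (G : bidirected_graph) := Contributor {
  con_val :> pre_contributor G;
  con_valP : [set head (con_val v) | v : vertex G] == [set: vertex G] }.

HB.instance Definition _ G := [isSub for @con_val G].
HB.instance Definition _ G := [Finite of contributor G by <:].

Definition unpacks (G : bidirected_graph) (p : pre_contributor G)
    (v : vertex G) (q : pre_contributor G) : Prop :=
  exists i e j w,
    [/\ step_val (p v) = (v, i, e, i, v), j != i,
        step_val (q v) = (v, i, e, j, w)
      & forall u, u != v -> q u = p u].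

Fixpoint unpacks_seq (G : bidirected_graph) (p : pre_contributor G)
    (vs : seq (vertex G)) (q : pre_contributor G) : Prop :=
  if vs is v :: vs' then
    exists r : pre_contributor G, unpacks p v r /\ unpacks_seq r vs' q
  else p = q.

Section Contributors.
Variable G : bidirected_graph.
Implicit Types c d : contributor G.

Lemma contributor_head_inj c : injective (fun v => head (c v)).
Proof.
have /eqP im := con_valP c.
have /imset_injP inj : #|[set head (c v) | v in vertex G]| == #|vertex G|.
  by rewrite im cardsT.
by move=> u v; apply: inj.
Qed.

Definition head_perm c : {perm vertex G} := perm (@contributor_head_inj c).

Definition tc c : nat :=
  #|[set K in porbits (head_perm c) |
      ~~ [exists v, (K == [set v]) && is_backstep (c v)]]|.

Definition activating c (vs : seq (vertex G)) d : Prop :=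
  unpacks_seq c vs d /\ tc d = (tc c).+1.

Definition activates c d : Prop :=
  exists vs, activating c vs d /\
    forall vs' d', subseq vs' vs -> activating c vs' d' -> vs' = vs.

Definition activation_le : contributor G -> contributor G -> Prop :=
  clos_refl_trans (contributor G) activates.

Definition activation_equiv : contributor G -> contributor G -> Prop :=
  clos_refl_sym_trans (contributor G) activation_le.

Definition is_activation_class (C : contributor G -> Prop) : Prop :=
  exists c, forall d, C d <-> activation_equiv c d.

End Contributors.

(** [C], ordered by [le], is a boolean lattice: it is order isomorphic to a
    complemented bounded distributive lattice. *)
Definition boolean_lattice (T : Type) (C : T -> Prop) (le : T -> T -> Prop) :
    Prop :=
  exists (disp : Order.disp_t) (L : ctbDistrLatticeType disp) (f : T -> L),
    [/\ forall x y, C x -> C y -> f x = f y -> x = y,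
        forall l, exists2 x, C x & f x = l
      & forall x y, C x -> C y -> (le x y <-> (f x <= f y)%O)].

(* Main.v *)
Require Import Defs.
From HB Require Import structures.
From mathcomp Require Import all_boot all_order all_algebra all_fingroup.
From Stdlib Require Import Relation_Operators.

(** Unpacking never changes the incidence at the tail of a step, so these tail
    incidences are constant on an activation class.  They determine a map [out]
    on the vertices (leave along the tail incidence, arrive at the other end of
    the edge), and a contributor amounts to the set [A] of its vertices that are
    not backsteps, subject to [A = out @: A].  Such a set is a union of cycles
    of [out], and an activation adds exactly one cycle.  Such sets are closed
    under union, so the class has a largest contributor, and it is isomorphic to
    the lattice of all sets of cycles of the latter. *)

Set Implicit Arguments.
Unset Strict Implicit.
Unset Printing Implicit Defensive.

Local Notation iota := (@Defs.iota _).
Local Notation head := (@Defs.head _).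

Import Order.DefaultSetSubsetOrder.

(** * Edges with two incidences, and the steps they carry *)

Section Mate.
Variable G : bidirected_graph.
Implicit Types (i j : incidence G) (s t : step G).

(** The other incidence of the same edge; the default value never occurs. *)
Definition mate i : incidence G :=
  odflt i [pick j | (j != i) && ((iota j).2 == (iota i).2)].

(** Any other value returned by [pick] would be a third incidence of an edge that has exactly
    two. *)
Lemma mateP i j : j != i -> (iota j).2 = (iota i).2 -> mate i = j.
Proof.
move=> ji eij; rewrite /mate; case: pickP => [k /andP[ki /eqP eki]|/(_ j)] /=;
  last by rewrite ji eij eqxx.
apply/eqP; apply: contraT => kj.
have := edge_incidences (iota i).2.
suff: 2 < #|[set k | (iota k).2 == (iota i).2]| by move=> + e; rewrite e.
have <- : #|[set i; j; k]| = 3.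
  by rewrite setUC cardsU1 cards2 !inE negb_or ki kj eq_sym ji.
by apply/subset_leq_card/subsetP => l; rewrite !inE => /orP[/orP[]|] /eqP->;
   rewrite ?eqxx ?eij ?eki.
Qed.

Lemma mate_edge i : (iota (mate i)).2 = (iota i).2.
Proof. by rewrite /mate; case: pickP => //= j /andP[_ /eqP]. Qed.

Lemma mate_neq i : mate i != i.
Proof.
have /eqP/cards2P[j [k [jk E]]] := edge_incidences (iota i).2.
have memE l : ((iota l).2 == (iota i).2) = (l \in [set j; k]) by rewrite -E inE.
have [l li /eqP el] : exists2 l, l != i & (iota l).2 == (iota i).2.
  have := memE i; rewrite eqxx => /esym/set2P[] iE.
    by exists k; rewrite ?memE ?set22 // iE eq_sym.
  by exists j; rewrite ?memE ?set21 // iE.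
by rewrite (mateP li el).
Qed.

Definition tail_inc s : incidence G := (step_val s).1.1.1.2.

Definition backstep_val i := ((iota i).1, i, (iota i).2, i, (iota i).1).
Definition adjacency_val i :=
  ((iota i).1, i, (iota i).2, mate i, (iota (mate i)).1).

Lemma backstep_valP i : incidence_preserving (backstep_val i).
Proof. by rewrite /= -surjective_pairing eqxx. Qed.

Lemma adjacency_valP i : incidence_preserving (adjacency_val i).
Proof. by rewrite /= -{2}(mate_edge i) -!surjective_pairing !eqxx. Qed.

(** The head incidence lies on the same edge, so it is either the tail incidence or its mate: a step
    amounts to its tail incidence and one bit. *)
Lemma step_valE s : step_val s =
  if is_backstep s then backstep_val (tail_inc s) else adjacency_val (tail_inc s).
Proof.
rewrite /is_backstep /tail_inc; case: s => -[[[[v i] e] j] w] /= /andP[/eqP iE /eqP jE].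
rewrite /backstep_val /adjacency_val iE /=.
case: eqP => [ij|/eqP ij]; first by rewrite -ij iE in jE *; case: jE => <-.
by rewrite (@mateP i j) 1?eq_sym ?jE ?iE.
Qed.

Lemma tail_tail_inc s : tail s = (iota (tail_inc s)).1.
Proof. by rewrite /tail step_valE; case: ifP. Qed.

Lemma head_tail_inc s : head s =
  if is_backstep s then tail s else (iota (mate (tail_inc s))).1.
Proof. by rewrite tail_tail_inc /head step_valE; case: ifP. Qed.

Lemma step_eq s t :
  tail_inc s = tail_inc t -> is_backstep s = is_backstep t -> s = t.
Proof.
move=> Ei Eb; apply: val_inj => /=.
by rewrite !step_valE Ei Eb.
Qed.

Definition backstep_at i := Step (backstep_valP i).
Definition adjacency_at i := Step (adjacency_valP i).

Lemma is_backstep_at i : is_backstep (backstep_at i).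
Proof. by rewrite /is_backstep /= eqxx. Qed.

Lemma is_backstep_adjacency_at i : is_backstep (adjacency_at i) = false.
Proof. by rewrite /is_backstep /= eq_sym (negPf (mate_neq i)). Qed.

End Mate.

(** * Pre-contributors as vertex sets, unpacking as insertion *)

Section PreContributors.
Variable G : bidirected_graph.
Implicit Types (p q r : pre_contributor G) (v : vertex G) (A : {set vertex G}).

Lemma pc_tail p v : tail (p v) = v.
Proof. by apply/eqP; case: p => p /= /forallP. Qed.

Definition active p : {set vertex G} := [set v | ~~ is_backstep (p v)].

(** The invariant of unpacking; on contributors it turns out to be activation equivalence. *)
Definition same_tails p q := forall v, tail_inc (p v) = tail_inc (q v).

Definition out p v : vertex G := (iota (mate (tail_inc (p v)))).1.

Lemma eq_out p q : same_tails p q -> out p =1 out q.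
Proof. by move=> E v; rewrite /out E. Qed.

Lemma pc_head p v : head (p v) = if v \in active p then out p v else v.
Proof. by rewrite head_tail_inc pc_tail inE; case: is_backstep. Qed.

Lemma pre_contributor_eq p q : same_tails p q -> active p = active q -> p = q.
Proof.
move=> E EA; apply: val_inj => /=; apply/ffunP => v; apply: step_eq; first exact: E.
by have /setP/(_ v) := EA; rewrite !inE => /negb_inj.
Qed.

Lemma pre_contributor_exists p A : exists2 q, same_tails p q & active q = A.
Proof.
pose f := [ffun v => if v \in A then adjacency_at (tail_inc (p v))
                     else backstep_at (tail_inc (p v))].
have ft v : tail_inc (f v) = tail_inc (p v) by rewrite ffunE; case: ifP.
have fP : [forall v, tail (f v) == v].
  by apply/forallP => v; rewrite tail_tail_inc ft -tail_tail_inc pc_tail.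
exists (PreContributor fP) => [v|] /=; first by rewrite ft.
apply/setP => v; rewrite inE /= ffunE.
by case: ifP => _; rewrite ?is_backstep_at ?is_backstep_adjacency_at.
Qed.

Lemma unpacksP p v q : unpacks p v q <->
  [/\ same_tails p q, v \notin active p & active q = v |: active p].
Proof.
split=> [[i [e [j [w [pv ji qv eqpq]]]]]|[E vp Eq]].
  have bp : is_backstep (p v) by rewrite /is_backstep pv eqxx.
  have bq : is_backstep (q v) = false by rewrite /is_backstep qv eq_sym (negPf ji).
  split=> [u||]; last 1 first.
  - apply/setP=> u; rewrite !inE; case: eqVneq => [->|uv] /=; first by rewrite bq.
    by rewrite eqpq.
  - have [->|uv] := eqVneq u v; last by rewrite eqpq.
    by rewrite /tail_inc pv qv.
  - by rewrite inE bp.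
have bp : is_backstep (p v) by move: vp; rewrite inE negbK.
have bq : is_backstep (q v) = false.
  by have /setP/(_ v) := Eq; rewrite !inE eqxx /= => /negbTE.
have tv : (iota (tail_inc (p v))).1 = v by rewrite -tail_tail_inc pc_tail.
exists (tail_inc (p v)), (iota (tail_inc (p v))).2, (mate (tail_inc (p v))),
  (iota (mate (tail_inc (p v)))).1.
split; first by rewrite step_valE bp /backstep_val tv.
- exact: mate_neq.
- by rewrite step_valE bq /adjacency_val -E tv.
move=> u uv; apply: step_eq; first by rewrite E.
by have /setP/(_ u) := Eq; rewrite !inE (negPf uv) => /negb_inj.
Qed.

(** The order of unpackings is free, because every intermediate vertex set is the active set of some
    pre-contributor, whose heads need not cover all vertices. Repetitions are impossible, since an
    unpacked vertex is no longer a backstep. *)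
Lemma unpacks_seqP p vs q : unpacks_seq p vs q <->
  [/\ same_tails p q, uniq vs, {in vs, forall v, v \notin active p}
    & active q = active p :|: [set:: vs]].
Proof.
elim: vs p => [|v vs IH] p /=.
  split=> [->|[E _ _ Eq]].
    by split=> //; apply/setP => u; rewrite !inE in_nil orbF.
  by apply: pre_contributor_eq => //; rewrite Eq; apply/setP => u; rewrite !inE in_nil orbF.
split=> [[r [/unpacksP[Er vp Ar] /IH[Eq vsU vsr Aq]]]|[E /andP[vvs vsU] vsp Aq]].
  split.
  - by move=> u; rewrite Er Eq.
  - rewrite vsU andbT; apply/negP => /vsr; by rewrite Ar !inE eqxx.
  - move=> u; rewrite inE => /orP[/eqP->//|/vsr]; rewrite Ar inE negb_or.
    by case/andP.
  - by rewrite Aq Ar; apply/setP => u; rewrite !inE; case: (u == v); rewrite ?orbT.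
have [r Er Ar] := pre_contributor_exists p (v |: active p).
exists r; split; first by apply/unpacksP; split=> //; apply: vsp; rewrite inE eqxx.
apply/IH; split=> //.
- by move=> u; rewrite -Er E.
- move=> u uvs; rewrite Ar in_setU1 negb_or vsp ?inE ?uvs ?orbT // andbT.
  by apply: contraNneq vvs => <-.
- by rewrite Aq Ar; apply/setP => u; rewrite !inE; case: (u == v); rewrite ?orbT.
Qed.

End PreContributors.

(** * Cycles of contributors and the activation order *)

Section Circles.
Variable G : bidirected_graph.
Implicit Types (c d e : contributor G) (u v x : vertex G).
Implicit Types (A K : {set vertex G}).

Lemma contributor_eq c d : same_tails c d -> active c = active d -> c = d.
Proof. by move=> E EA; apply: val_inj; apply: pre_contributor_eq. Qed.

Lemma head_permE c v : head_perm c v = if v \in active c then out c v else v.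
Proof. by rewrite permE pc_head. Qed.

(** Inactive vertices are fixed points; if an active vertex were sent to one, injectivity would make
    the two equal. *)
Lemma head_perm_active c v : (head_perm c v \in active c) = (v \in active c).
Proof.
have [va|va] := boolP (v \in active c); last by rewrite head_permE (negPf va) (negPf va).
apply: contraT => ha.
have : head_perm c (head_perm c v) = head_perm c v by rewrite [LHS]head_permE (negPf ha).
by move/perm_inj => E; rewrite E va in ha.
Qed.

Lemma out_active c : out c @: active c = active c.
Proof.
apply/setP => v; apply/imsetP/idP => [[u ua ->]|va].
  by have := head_perm_active c u; rewrite head_permE ua.
have E := permKV (head_perm c) v.
have ua : (head_perm c)^-1%g v \in active c by rewrite -head_perm_active E.
by exists ((head_perm c)^-1%g v) => //; rewrite -[LHS]E head_permE ua.
Qed.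

(** An image is never larger than the set, so the inclusion is already an equality. The inclusion is
    the form that passes directly to unions. *)
Lemma contributor_exists c A : A \subset out c @: A ->
  exists2 d : contributor G, same_tails c d & active d = A.
Proof.
move=> sA; have cA : #|out c @: A| = #|A|.
  by apply/eqP; rewrite eqn_leq leq_imset_card subset_leq_card.
have oA : out c @: A = A by apply/esym/eqP; rewrite eqEcard sA cA leqnn.
have [p Ep Ap] := pre_contributor_exists c A.
suff pP : [set head (p v) | v in vertex G] == [set: vertex G].
  by exists (Contributor pP).
apply/eqP/setP => v; rewrite inE; apply/imsetP.
have [vA|vA] := boolP (v \in A); last by exists v; rewrite // pc_head Ap (negPf vA).
by move: (vA); rewrite -oA => /imsetP[u uA ->]; exists u; rewrite // pc_head Ap uA (eq_out Ep).
Qed.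

Lemma porbit_active c x : x \in active c -> porbit (head_perm c) x \subset active c.
Proof.
move=> xa; apply/subsetP => y /porbitP[n ->].
by elim: n => [|n IH]; rewrite ?expg0 ?perm1 // expgSr permM head_perm_active.
Qed.

(** Each point of a cycle is the image of its predecessor; this is what [contributor_exists] needs
    in order to add or select whole circles. *)
Lemma porbit_sub_out c x : x \in active c ->
  porbit (head_perm c) x \subset out c @: porbit (head_perm c) x.
Proof.
move=> xa; apply/subsetP => y yx; apply/imsetP.
pose z := (head_perm c)^-1%g y; have E : head_perm c z = y by rewrite permKV.
have yz : y \in porbit (head_perm c) z by apply/porbitP; exists 1; rewrite expg1.
have zx : z \in porbit (head_perm c) x.
  by move: yx yz; rewrite -!eq_porbit_mem => /eqP<- /eqP->.
by exists z; rewrite // -{1}E head_permE (subsetP (porbit_active xa) _ zx).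
Qed.

(** The orbit of [x] never leaves [active c], and there both permutations are the common map
    [out]. *)
Lemma porbit_same_tails c d x : same_tails c d -> active c \subset active d ->
  x \in active c -> porbit (head_perm c) x = porbit (head_perm d) x.
Proof.
move=> E sub xa.
have H n : (head_perm c ^+ n)%g x = (head_perm d ^+ n)%g x.
  elim: n => [|n IH]; first by rewrite !expg0.
  rewrite !expgSr !permM -IH !head_permE.
  have ya : (head_perm c ^+ n)%g x \in active c.
    by apply: (subsetP (porbit_active xa)); apply: mem_porbit.
  by rewrite ya (subsetP sub _ ya) (eq_out E).
by apply/setP => y; apply/porbitP/porbitP => -[n ->]; exists n; rewrite H.
Qed.

Definition circles c : {set {set vertex G}} := porbit (head_perm c) @: active c.

(** The orbits discarded by [tc] are those of inactive vertices. A loop is also a one-element orbit,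
    but its vertex is active, so it is kept. *)
Lemma tcE c : tc c = #|circles c|.
Proof.
congr #|pred_of_set _|; apply/setP => K; rewrite inE.
apply/andP/imsetP => [[/imsetP[x _ ->] nb]|[x xa ->]].
  exists x => //; rewrite inE; apply: contra nb => bx.
  apply/existsP; exists x; rewrite bx andbT.
  have xa : x \notin active c by rewrite inE negbK.
  rewrite eqEsubset sub1set porbit_id andbT; apply/subsetP => y /porbitP[n ->].
  elim: n => [|n]; first by rewrite expg0 perm1 inE.
  by rewrite expgSr permM !inE => /eqP->; rewrite head_permE (negPf xa).
split; first exact: imset_f.
apply/existsP => -[v /andP[/eqP E bv]].
have := porbit_id (head_perm c) x; rewrite E inE => /eqP xv.
by rewrite xv inE bv in xa.
Qed.

Lemma cover_circles c : cover (circles c) = active c.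
Proof.
apply/setP => x; apply/bigcupP/idP => [[K /imsetP[y ya ->]]|xa].
  exact: (subsetP (porbit_active ya)).
by exists (porbit (head_perm c) x); rewrite ?imset_f ?porbit_id.
Qed.

Lemma circles_sub c d : same_tails c d -> active c \subset active d ->
  circles c \subset circles d.
Proof.
move=> E sub; apply/subsetP => K /imsetP[x xa ->].
by rewrite (porbit_same_tails E sub xa) imset_f // (subsetP sub).
Qed.

Lemma activating_sub c vs d : activating c vs d ->
  [/\ same_tails c d, active c \subset active d
    & perm_eq vs (enum (active d :\: active c))].
Proof.
case=> /unpacks_seqP[E U N ->] _; split=> //; first exact: subsetUl.
apply: uniq_perm; rewrite ?enum_uniq // => v; rewrite mem_enum !inE.
have [va|va] := boolP (~~ is_backstep (c v)) => //=.
by apply/negbTE/negP => /N; rewrite inE va.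
Qed.

(** Minimality is automatic: raising [tc] by one adds a single circle, and no proper part of the
    unpackings can complete it. *)
Lemma activatesP c d : activates c d <->
  [/\ same_tails c d, active c \subset active d & tc d = (tc c).+1].
Proof.
split=> [[vs [act _]]|[E sub tcd]].
  by have [E sub _] := activating_sub act; split=> //; case: act.
have act : activating c (enum (active d :\: active c)) d.
  split=> //; apply/unpacks_seqP; split=> //; first exact: enum_uniq.
    by move=> v; rewrite mem_enum inE => /andP[].
  by rewrite set_enum -{1}(setID (active d) (active c)) (setIidPr sub).
exists (enum (active d :\: active c)); split=> // vs d' ss act'.
have [E' sub' pvs] := activating_sub act'; have [_ _ pvs0] := activating_sub act.
have Ed : same_tails d' d by move=> v; rewrite -E' E.
have subd : active d' \subset active d.
  apply/subsetP => v vd'; have [va|va] := boolP (v \in active c); first exact: (subsetP sub).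
  have : v \in vs by rewrite (perm_mem pvs) mem_enum inE va.
  by move/(mem_subseq ss); rewrite mem_enum inE => /andP[].
(* [circles d'] is contained in [circles d] and has the same size [(tc c).+1], so they agree, and
   their covers are the active sets. *)
have EA : active d' = active d.
  rewrite -!cover_circles; congr cover; apply/eqP.
  by rewrite eqEcard circles_sub //= -!tcE tcd (proj2 act').
apply/eqP; rewrite -(size_subseq_leqif ss).
by rewrite (perm_size pvs) EA.
Qed.

(** For the converse, circles of [d] are added to [c] one at a time, by induction on the number of
    active vertices still missing. *)
Lemma activation_leP c d :
  activation_le c d <-> same_tails c d /\ active c \subset active d.
Proof.
split=> [|[]].
  elim=> {c d} [c d /activatesP[]|c|c d e _ [E1 s1] _ [E2 s2]] //.
  by split=> [v|]; [rewrite E1 E2 | exact: subset_trans s2].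
have [n] := ubnP #|active d :\: active c|.
elim: n c => // n IH c /ltnSE le_n E sub.
have [s0|[x]] := set_0Vmem (active d :\: active c).
  have -> : c = d; last exact: rt_refl.
  by apply: contributor_eq => //; apply/eqP; rewrite eqEsubset sub -setD_eq0 s0 /=.
rewrite inE => /andP[xc xd].
pose K := porbit (head_perm d) x.
have [e Ee Ae] : exists2 e : contributor G, same_tails c e & active e = active c :|: K.
  apply: contributor_exists; rewrite imsetU out_active setUS //.
  by rewrite (eq_imset _ (eq_out E)) porbit_sub_out.
have Eed : same_tails e d by move=> v; rewrite -Ee E.
have sce : active c \subset active e by rewrite Ae subsetUl.
have sed : active e \subset active d by rewrite Ae subUset sub porbit_active.
have xe : x \in active e by rewrite Ae inE porbit_id orbT.
apply: (rt_trans _ _ _ e).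
  apply: rt_step; apply/activatesP; split=> //; rewrite !tcE.
  (* Circles of [c] and of [e] are circles of [d], so enlarging the active set by [K] creates [K]
     and merges or splits nothing. *)
  have -> : circles e = K |: circles c.
    apply/setP => L; rewrite in_setU1; apply/idP/idP.
      case/imsetP => y ye ->; rewrite (porbit_same_tails Eed sed ye).
      move: ye; rewrite Ae inE => /orP[yc|yK].
        by rewrite -(porbit_same_tails E sub yc) imset_f ?orbT.
      by rewrite eq_porbit_mem yK.
    case/orP=> [/eqP->|]; last exact/subsetP/circles_sub.
    by rewrite /K -(porbit_same_tails Eed sed xe) imset_f.
  rewrite cardsU1; suff -> : K \notin circles c by [].
  apply: contra xc => Kc; rewrite -cover_circles.
  by apply/bigcupP; exists K; rewrite ?porbit_id.
apply: IH => //; apply: leq_trans le_n; apply: proper_card.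
apply/properP; split; first exact: setDS.
by exists x; rewrite in_setD ?xe // xc xd.
Qed.

Lemma activation_equivP c d : activation_equiv c d <-> same_tails c d.
Proof.
split=> [|E].
  elim=> {c d} [c d /activation_leP[]|c|c d _ E|c d e _ E1 _ E2] // v.
  by rewrite E1 E2.
(* [b] consists of backsteps only and lies below both [c] and [d]. *)
have [b Eb Ab] := contributor_exists (sub0set (out c @: set0)).
apply: (rst_trans _ _ _ b).
  by apply: rst_sym; apply: rst_step; apply/activation_leP; split=> [v|]; rewrite ?Eb // Ab sub0set.
by apply: rst_step; apply/activation_leP; split=> [v|]; rewrite -?Eb ?E // Ab sub0set.
Qed.

Lemma top_contributor c : exists2 m : contributor G, same_tails c m &
  forall d, same_tails c d -> active d \subset active m.
Proof.
(* As in the Knaster-Tarski theorem, the union of all sets contained in their image is again such a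
   set, hence the largest one. *)
pose M := \bigcup_(A : {set vertex G} | A \subset out c @: A) A.
have [m Em Am] : exists2 m : contributor G, same_tails c m & active m = M.
  apply: contributor_exists; apply/bigcupsP => A sA.
  exact: subset_trans sA (imsetS _ (bigcup_sup A sA)).
exists m => // d Ed; rewrite Am; apply: (bigcup_sup (active d)).
by rewrite (eq_imset _ (eq_out Ed)) out_active.
Qed.

End Circles.

Theorem lemma3p6 (G : bidirected_graph)
    (hG : forall K, K \in components G -> has_adjacency K)
    (C : contributor G -> Prop) (hC : is_activation_class C) :
  boolean_lattice C (@activation_le G).
Proof.
have [c0 HC] := hC.
have CP d : C d <-> same_tails c0 d by exact: iff_trans (HC d) (activation_equivP c0 d).
have [m Em top] := top_contributor c0.
pose T := {K : {set vertex G} | K \in circles m}.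
pose block K (Km : K \in circles m) : T := exist _ K Km.
pose f (c : contributor G) := [set K : T | val K \subset active c] : {set T}.
have leP c d : C c -> C d -> (active c \subset active d) = (f c <= f d)%O.
  move=> /CP Ec /CP Ed; rewrite Order.SetSubsetOrder.leEsubset.
  apply/idP/idP => [sub|/subsetP sub]; apply/subsetP.
    by move=> K; rewrite !inE => /subset_trans; apply.
  (* The circle of [m] through [x] is also the orbit of [x] under [c], so it belongs to [f c]: an
     active set is recovered as the union of the circles of [m] inside it. *)
  move=> x xc; have xm := subsetP (top c Ec) _ xc.
  have Km : porbit (head_perm m) x \in circles m by apply: imset_f.
  have Ecm : same_tails c m by move=> v; rewrite -Ec Em.
  have : block _ Km \in f d.
    by apply: sub; rewrite inE /= -(porbit_same_tails Ecm (top c Ec) xc) porbit_active.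
  by rewrite inE /= => /subsetP; apply; apply: porbit_id.
exists _, {set T}, f; split.
- move=> c d Cc Cd E; apply: contributor_eq.
    by move=> v; rewrite -(proj1 (CP c) Cc) (proj1 (CP d) Cd).
  by apply/eqP; rewrite eqEsubset !leP // E Order.POrderTheory.lexx.
(* Surjectivity: the preimage of [S] is the contributor active exactly on the union of the circles
   in [S]. *)
- move=> S; pose A := \bigcup_(K in S) val K.
  have [d Ed Ad] : exists2 d : contributor G, same_tails c0 d & active d = A.
    apply: contributor_exists; apply/bigcupsP => -[K Km] KS.
    apply: subset_trans (imsetS _ (bigcup_sup _ KS)) => /=.
    have /imsetP[x xm ->] := Km.
    by rewrite (eq_imset _ (eq_out Em)) porbit_sub_out.
  exists d; first exact/CP.
  apply/setP => -[K Km]; rewrite inE /= Ad; apply/idP/idP => [/subsetP sKA|KS].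
    have /imsetP[x xm KE] := Km.
    have /bigcupP[[L Lm] LS xL] : x \in A by apply: sKA; rewrite KE porbit_id.
    (* [K] and [L] are orbits of the same permutation sharing [x], so they coincide and no circle
       outside [S] is contained in [A]. *)
    suff E : block _ Km = block _ Lm by rewrite -/(block K Km) E.
    apply: val_inj => /=; have /imsetP[y ym LE] := Lm.
    by apply/eqP; rewrite KE LE eq_porbit_mem -LE.
  exact: (bigcup_sup (block _ Km)).
- move=> c d Cc Cd; rewrite -leP //; split=> [/activation_leP[]//|sub].
  apply/activation_leP; split=> // v; by rewrite -(proj1 (CP c) Cc) (proj1 (CP d) Cd).
Qed.
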